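(* Let $\lambda\in\mathbb R_+$ and let $\widehat{\mathcal S}_\lambda$ be the set of tensors $\psi\in\mathbb R^{r_1\times\cdots\times r_p}$ for which there exist vectors $\theta^{(k)}\in\mathbb R^{r_k}$ ($k\in[p]$) and real numbers $y_{x,k}$ ($x\in\mathcal R$, $k\in[p]$) such that $$\begin{aligned} &\psi_x=\lambda\, y_{x,1} && x\in\mathcal R,\\ &y_{x,k}\ge -\theta^{(k)}_{x_k}-y_{x,k+1}-1 && k\in[p-1],\ x\in\mathcal R,\\ &y_{x,k}\ge \theta^{(k)}_{x_k}+y_{x,k+1}-1 && k\in[p-1],\ x\in\mathcal R,\\ &y_{x,k}\le \theta^{(k)}_{x_k}-y_{x,k+1}+1 && k\in[p-1],\ x\in\mathcal R,\\ &y_{x,k}\le -\theta^{(k)}_{x_k}+y_{x,k+1}+1 && k\in[p-1],\ x\in\mathcal R,\\ &y_{x,p}=\theta^{(p)}_{x_p} && x\in\mathcal R,\\ &\theta^{(k)}_{x_k}\in\{-1,1\} && k\in[p],\ x\in\mathcal R. \end{aligned}$$ Then $\widehat{\mathcal S}_\lambda=\mathcal S_\lambda$.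
   Context: Fix an order $p\ge1$ and dimensions $r_1,\dots,r_p\ge1$; $[s]=\{1,\dots,s\}$ and $\mathcal R=[r_1]\times\cdots\times[r_p]$. For a tensor $\psi\in\mathbb R^{r_1\times\cdots\times r_p}$ and $x=(x_1,\dots,x_p)\in\mathcal R$, $\psi_x$ denotes the entry with indices $x$. For $\lambda\in\mathbb R_+$, $$\mathcal S_\lambda=\Big\{\psi:\ \exists\,\theta^{(k)}\in\{-1,1\}^{r_k}\ (k\in[p])\text{ with }\psi_x=\lambda\prod_{k=1}^p\theta^{(k)}_{x_k}\ \forall x\in\mathcal R\Big\}.$$ *)

(* Defs.v *)
From mathcomp Require Import all_boot all_order all_algebra.
From mathcomp Require Import classical_sets reals.

Set Implicit Arguments.
Unset Strict Implicit.
Unset Printing Implicit Defensive.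

Import Order.TTheory GRing.Theory Num.Theory.
Local Open Scope ring_scope.
Local Open Scope classical_set_scope.

(* Modes and entries are numbered from 0: the mode k of [p] is the ordinal
   k - 1 of 'I_p, and [r_k] is 'I_(r k). *)
Definition multi_index (p : nat) (r : 'I_p -> nat) :=
  {dffun forall k : 'I_p, 'I_(r k)}.

Definition tensor (R : realType) (p : nat) (r : 'I_p -> nat) :=
  {ffun multi_index r -> R}.

Definition sign_tensors (R : realType) (p : nat) (r : 'I_p -> nat)
    (lambda : R) : set (tensor R r) :=
  [set psi | exists theta : forall k : 'I_p, 'rV[R]_(r k),
    (forall (k : 'I_p) (i : 'I_(r k)), theta k 0 i = -1 \/ theta k 0 i = 1) /\
    (forall x : multi_index r,
      psi x = lambda * \prod_(k < p) theta k 0 (x k))].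

(* A mode k with k = 0 is the first one, with k.+1 = p the last one; the
   pairs (k, l) with l = k.+1 are the pairs of consecutive modes, so that k
   ranges over all modes but the last. *)
Definition sign_tensors_lin (R : realType) (p : nat) (r : 'I_p -> nat)
    (lambda : R) : set (tensor R r) :=
  [set psi | exists (theta : forall k : 'I_p, 'rV[R]_(r k))
                    (y : multi_index r -> 'I_p -> R),
    [/\ forall (x : multi_index r) (k : 'I_p), k = 0%N :> nat ->
          psi x = lambda * y x k,
        forall (k l : 'I_p) (x : multi_index r), l = k.+1 :> nat ->
          [/\ y x k >= - theta k 0 (x k) - y x l - 1,
              y x k >= theta k 0 (x k) + y x l - 1,
              y x k <= theta k 0 (x k) - y x l + 1
            & y x k <= - theta k 0 (x k) + y x l + 1],
        forall (x : multi_index r) (k : 'I_p), k.+1 = p ->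
          y x k = theta k 0 (x k)
      & forall (k : 'I_p) (x : multi_index r),
          theta k 0 (x k) = -1 \/ theta k 0 (x k) = 1]].

(* Main.v *)
Require Import Defs.
From mathcomp Require Import all_boot all_order all_algebra.
From mathcomp Require Import classical_sets reals.
From mathcomp Require Import lra zify.

(** The linear inequalities relating [y_{x,k}], [theta^(k)_{x_k}] and
    [y_{x,k+1}] cut out exactly the product
    [y_{x,k} = theta^(k)_{x_k} * y_{x,k+1}] when the last two are signs, so
    downward induction on [k] forces [y_{x,k}] to be the product of the
    [theta^(j)_{x_j}] over [j >= k]. *)

Import Order.TTheory GRing.Theory Num.Theory.

Local Open Scope ring_scope.

(** If [t = 1], the second and fourth inequalities pinch [a] to [u]; if [t = -1], the first and
    third pinch it to [- u]. The remaining two then amount to [-1 <= u <= 1]. *)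
Lemma sign_mul_linP (R : realDomainType) (t u a : R) :
  t = -1 \/ t = 1 -> u = -1 \/ u = 1 ->
  [/\ a >= - t - u - 1, a >= t + u - 1, a <= t - u + 1 & a <= - t + u + 1]
  <-> a = t * u.
Proof.
move=> [->|->] [->|->]; rewrite ?mulrNN ?mulrN ?mulNr ?mulr1;
  by split=> [[? ? ? ?]|->]; [lra | split; lra].
Qed.

Lemma prod_signs (R : pzRingType) (I : Type) (s : seq I) (P : pred I)
    (f : I -> R) :
  (forall i, f i = -1 \/ f i = 1) ->
  \prod_(i <- s | P i) f i = -1 \/ \prod_(i <- s | P i) f i = 1.
Proof.
move=> fS; elim/big_rec: _ => [|i c _ cS]; first by right.
by case: (fS i) => ->; case: cS => ->; rewrite ?mulrNN ?mulN1r ?mul1r; auto.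
Qed.

Lemma prod_ord_geS (R : comPzRingType) (p : nat) (f : 'I_p -> R)
    (k l : 'I_p) :
  l = k.+1 :> nat ->
  \prod_(j < p | (k <= j)%N) f j = f k * \prod_(j < p | (l <= j)%N) f j.
Proof.
move=> lk; rewrite (bigD1 k) //=; congr (_ * _).
by apply: eq_bigl => j; rewrite lk ltn_neqAle andbC eq_sym.
Qed.

Lemma prod_ord_ge_last (R : comPzRingType) (p : nat) (f : 'I_p -> R)
    (k : 'I_p) :
  k.+1 = p -> \prod_(j < p | (k <= j)%N) f j = f k.
Proof.
move=> kp; apply: big_pred1 => j /=; rewrite -val_eqE /=.
by have := ltn_ord j; lia.
Qed.

Lemma prod_ord_ge_first (R : comPzRingType) (p : nat) (f : 'I_p -> R)
    (k : 'I_p) :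
  k = 0%N :> nat -> \prod_(j < p | (k <= j)%N) f j = \prod_(j < p) f j.
Proof. by move=> k0; apply: eq_bigl => j; rewrite k0. Qed.

(** The step hypothesis may assume that [y l] is already a suffix product: when [f] takes sign
    values, [y l] is then a sign, as [sign_mul_linP] requires. *)
Lemma eq_suffix_prod (R : comPzRingType) (p : nat) (f y : 'I_p -> R) :
  (forall k : 'I_p, k.+1 = p -> y k = f k) ->
  (forall k l : 'I_p, l = k.+1 :> nat ->
     y l = \prod_(j < p | (l <= j)%N) f j -> y k = f k * y l) ->
  forall k, y k = \prod_(j < p | (k <= j)%N) f j.
Proof.
(* Downward induction on [k], run as induction on a strict bound [m] of [p - k]. *)
move=> ylast ystep k; have [m] := ubnP (p - k).
elim: m k => // m IHm k pkm.
have [kp|] := eqVneq k.+1 p; first by rewrite ylast // prod_ord_ge_last.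
move=> kp; have lp : (k.+1 < p)%N by have := ltn_ord k; lia.
have yl := IHm (Ordinal lp) ltac:(move=> /=; lia).
by rewrite (ystep _ (Ordinal lp)) // (@prod_ord_geS _ _ _ _ (Ordinal lp)) // yl.
Qed.

(** The linear system constrains only entries of [theta] met by some multi-index; this carries the
    sign condition to every entry. Coordinates other than [k] are set to 0, which exists since each
    [r j] is positive. *)
Lemma multi_index_through (p : nat) (r : 'I_p -> nat)
    (hr : forall k : 'I_p, (1 <= r k)%N) (k : 'I_p) (i : 'I_(r k)) :
  exists x : multi_index r, x k = i.
Proof.
exists [ffun j => dfwith (fun j => Ordinal (hr j)) i j].
by rewrite ffunE dfwith_in.
Qed.

Theorem proposition3 (R : realType) (p : nat) (hp : (1 <= p)%N)
    (r : 'I_p -> nat) (hr : forall k : 'I_p, (1 <= r k)%N)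
    (lambda : R) (hlambda : 0 <= lambda) :
  sign_tensors_lin (r := r) lambda = sign_tensors (r := r) lambda.
Proof.
apply/seteqP; split=> psi /=.
- move=> [theta [y [psiE ylin ylast thetaS]]]; exists theta; split.
    by move=> k i; have [x <-] := @multi_index_through _ _ hr _ i.
  move=> x; rewrite (psiE _ (Ordinal hp)) //; congr (_ * _).
  rewrite -(@prod_ord_ge_first _ _ _ (Ordinal hp)) //.
  apply: (@eq_suffix_prod _ _ (fun k => theta k 0 (x k))) => [k|k l lk yl].
    exact: ylast.
  apply/sign_mul_linP; [exact: thetaS | | exact: ylin].
  by rewrite yl; apply: prod_signs => j; apply: thetaS.
- move=> [theta [thetaS psiE]]; exists theta.
  (* The suffix products are the only possible choice, by the first inclusion. *)
  exists (fun x k => \prod_(j < p | (k <= j)%N) theta j 0 (x j)); split.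
  + by move=> x k k0; rewrite psiE prod_ord_ge_first.
  + move=> k l x lk; apply/sign_mul_linP; first exact: thetaS.
      by apply: prod_signs => j; apply: thetaS.
    exact: prod_ord_geS.
  + by move=> x k kp; apply: prod_ord_ge_last.
  + by move=> k x; apply: thetaS.
Qed.
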